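(* Let $P$ be a Dedekind Poisson algebra over an arbitrary field $F$. Then $$P(+,\cdot)=E\oplus N,$$ where $E=0$ or $E=Fe$ with $e\neq0$, $e^2=e$, and, when $E\neq0$, $eN=0$. Moreover, $$N^3=0,\qquad \dim_F N^2\le 1,\qquad \operatorname{Ann}(N)=\{x\in N\mid x^2=0\}.$$ The non-zero idempotent $e$ of $P(+,\cdot)$, when it exists, is unique.
   Context: A Poisson algebra over a field $F$ is an $F$-vector space $P$ with a bilinear commutative associative multiplication $xy$ (no identity element is assumed) and an alternating Lie bracket $[\,,\,]$ ($[x,x]=0$ for all $x$) satisfying $[xy,z]=x[y,z]+y[x,z]$. A Poisson subalgebra is a subspace closed under both operations; a Poisson ideal is a subspace $I$ with $PI\subseteq I$ and $[P,I]\subseteq I$. A Poisson algebra is Dedekind if every Poisson subalgebra is a Poisson ideal. No finite-dimensionality is assumed. $P(+,\cdot)$ denotes $P$ regarded as a commutative associative algebra, and $E\oplus N$ is a direct sum of associative algebras (so $E$ and $N$ are ideals of $P(+,\cdot)$). $N^2$ is the linear span of all products $xy$ with $x,y\in N$, $N^3=N^2N$ (linear span of products), and $\operatorname{Ann}(N)=\{a\in N\mid aN=0\}$. An idempotent is an element $e$ with $e^2=e$. *)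

(* Defs.v *)
From HB Require Import structures.
From mathcomp Require Import all_boot all_algebra.
From mathcomp Require Import classical_sets.

Set Implicit Arguments.
Unset Strict Implicit.
Unset Printing Implicit Defensive.

Import GRing.Theory.
Local Open Scope ring_scope.
Local Open Scope classical_set_scope.

(* MathComp rings carry a unit, whereas the commutative product of a Poisson
   algebra need not have one: [pmul] is therefore not a GRing product. *)
HB.mixin Record isPoissonAlgebra (F : fieldType) P of GRing.Lmodule F P := {
  pmul : P -> P -> P;
  plie : P -> P -> P;
  pmul_bilinear : bilinear_for *:%R *:%R pmul;
  pmulC : commutative pmul;
  pmulA : associative pmul;
  plie_bilinear : bilinear_for *:%R *:%R plie;
  pliexx : forall x, plie x x = 0;
  plie_jacobi : forall x y z,
    plie x (plie y z) + plie y (plie z x) + plie z (plie x y) = 0;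
  plie_leibniz : forall x y z,
    plie (pmul x y) z = pmul x (plie y z) + pmul y (plie x z)
}.

#[short(type="poissonAlgType")]
HB.structure Definition PoissonAlgebra (F : fieldType) :=
  {P of isPoissonAlgebra F P & GRing.Lmodule F P}.

Section LinearAlgebra.
Variables (F : fieldType) (V : lmodType F).
Implicit Types S T : set V.

Definition subspace S :=
  S 0 /\ forall (a : F) x y, S x -> S y -> S (a *: x + y).

Definition lspan S : set V :=
  [set x | exists (n : nat) (c : 'I_n -> F) (v : 'I_n -> V),
     (forall i, S (v i)) /\ x = \sum_(i < n) c i *: v i].

Definition linearly_independent n (v : 'I_n -> V) :=
  forall c : 'I_n -> F, \sum_(i < n) c i *: v i = 0 -> forall i, c i = 0.

Definition is_basis S n (v : 'I_n -> V) :=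
  linearly_independent v /\ lspan (range v) = S.

Definition dim_le S (m : nat) :=
  exists (n : nat) (v : 'I_n -> V), (n <= m)%N /\ is_basis S v.

End LinearAlgebra.

Section Poisson.
Variables (F : fieldType) (P : poissonAlgType F).
Implicit Types S T I J : set P.

Definition poisson_subalgebra S :=
  [/\ subspace S,
      forall x y, S x -> S y -> S (pmul x y) &
      forall x y, S x -> S y -> S (plie x y)].

Definition poisson_ideal I :=
  [/\ subspace I,
      forall x y, I y -> I (pmul x y) &
      forall x y, I y -> I (plie x y)].

Definition dedekind := forall S, poisson_subalgebra S -> poisson_ideal S.

(* Ideals of the associative algebra P(+,.): the Lie bracket plays no role. *)
Definition assoc_ideal I :=
  subspace I /\ forall x y, I y -> I (pmul x y).

Definition assoc_direct_sum I J :=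
  [/\ assoc_ideal I, assoc_ideal J,
      forall x, exists y z, [/\ I y, J z & x = y + z] &
      I `&` J = [set 0]].

Definition prod_span S T : set P :=
  lspan [set pmul x y | x in S & y in T].

Definition Ann S : set P := [set a | S a /\ forall x, S x -> pmul a x = 0].

Definition idempotent_elt (e : P) := pmul e e = e.

End Poisson.

Arguments dedekind {F} P.

(* Main.v *)
Require Import Defs.
From mathcomp Require Import all_boot all_algebra.
From mathcomp Require Import boolp classical_sets.
Local Open Scope ring_scope.
Local Open Scope classical_set_scope.

(** Write <x> for the associative subalgebra generated by x.  Since x commutes
    with itself for the bracket, the Leibniz rule makes the bracket vanish on
    <x>, so <x> is a Poisson subalgebra and hence an ideal
    ([gen_absorb]).  Everything else is commutative associative algebra drawn
    from this single fact.

    First, x is algebraic: x^3 = x * x^2 lies in the ideal <x^2>, and comparing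
    it with even powers of x produces u in <x> with x^3 = x^3 u
    ([cube_local_unit]).  Then u^3 is an idempotent g of <x> that fixes x^3, so
    that x - gx has cube zero ([idempotent_absorbing_cube]).

    Secondly, if e is a nonzero idempotent, <e> = Fe is an ideal.  Two distinct
    nonzero idempotents e, f would be orthogonal, and then e = e(e + f) would
    lie in F(e + f), which is impossible ([idempotent_unique]).  With e the
    nonzero idempotent if there is one and 0 otherwise, the Peirce
    decomposition of P is Fe + N with N the annihilator of e, and N contains no
    nonzero idempotent, so every x in N has x^3 = 0 ([peirce_cube0]).

    Finally, for x, y in N the product xy lies in <x> = Fx + Fx^2, and
    nilpotency of y removes the linear term: xy = b x^2 ([mul_sub_sq]).  Thus
    x^2 = 0 forces xN = 0, and N^3 = 0 because xyz is a multiple of x^2 z, which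
    is a multiple of (x^2)^2 = 0.  If xy = 0 then
    x^2 = (x + y)x lies in F(x^2 + y^2), so any two nonzero squares are
    proportional ([squares_collinear]) and N^2 is at most a line. *)

Set Implicit Arguments.
Unset Strict Implicit.
Import GRing.Theory.

(** * Linear spans *)

Section Spans.
Variables (F : fieldType) (V : lmodType F).
Implicit Types S T : set V.

Lemma subspace0 S : subspace S -> S 0.
Proof. by case. Qed.

Lemma subspaceD S x y : subspace S -> S x -> S y -> S (x + y).
Proof. by move=> [_ h] Sx Sy; rewrite -[x]scale1r; apply: h. Qed.

Lemma subspaceZ S a x : subspace S -> S x -> S (a *: x).
Proof. by move=> [h0 h] Sx; rewrite -[_ *: _]addr0; apply: h. Qed.

Lemma subspaceB S x y : subspace S -> S x -> S y -> S (x - y).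
Proof.
by move=> hS Sx Sy; rewrite -scaleN1r; apply: subspaceD => //; apply: subspaceZ.
Qed.

Lemma subspace_set0 : subspace [set (0 : V)].
Proof. by split=> // a x y /= -> ->; rewrite scaler0 addr0. Qed.

Lemma subspace_line (e : V) : subspace [set a *: e | a in [set: F]].
Proof.
split; first by exists 0; rewrite ?scale0r.
move=> a _ _ [b _ <-] [c _ <-]; exists (a * b + c) => //.
by rewrite scalerDl scalerA.
Qed.

Lemma lspan_subset_subspace S T : subspace T -> S `<=` T -> lspan S `<=` T.
Proof.
move=> hT ST _ [n [c [v [Sv ->]]]]; apply: (big_ind T) => [|x y|i _].
- exact: subspace0.
- exact: subspaceD.
- by apply: subspaceZ => //; apply: ST.
Qed.

Lemma lspan0 S : lspan S 0.
Proof.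
exists 0%N, (fun=> 0 : F), (fun=> 0 : V); split; first by case.
by rewrite big_ord0.
Qed.

Lemma lspan_line (e : V) :
  lspan (range (fun _ : 'I_1 => e)) = [set a *: e | a in [set: F]].
Proof.
apply/seteqP; split.
  apply: lspan_subset_subspace; first exact: subspace_line.
  by move=> _ [_ _ <-]; exists 1; rewrite ?scale1r.
move=> _ [a _ <-]; exists 1%N, (fun=> a), (fun=> e); split.
  by move=> _; exists ord0.
by rewrite big_ord1.
Qed.

End Spans.

(** * Bilinearity of the operations *)

Section PoissonTheory.
Variables (F : fieldType) (P : poissonAlgType F).
Implicit Types (x y z u e : P) (a b c : F) (S I N : set P).

Local Notation "x ** y" := (pmul x y) (at level 40, left associativity).

Lemma pmulDZl a x y z : (a *: x + y) ** z = a *: (x ** z) + y ** z.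
Proof. exact: (fst pmul_bilinear). Qed.

Lemma pmul0l z : 0 ** z = 0.
Proof. by have := pmulDZl (-1) 0 0 z; rewrite scaler0 addr0 scaleN1r addNr. Qed.

Lemma pmulZl a x z : (a *: x) ** z = a *: (x ** z).
Proof. by rewrite -[a *: x]addr0 pmulDZl pmul0l addr0. Qed.

Lemma pmulDl x y z : (x + y) ** z = x ** z + y ** z.
Proof. by rewrite -[x]scale1r pmulDZl !scale1r. Qed.

Lemma pmul0r z : z ** 0 = 0.
Proof. by rewrite pmulC pmul0l. Qed.

Lemma pmulZr a x z : z ** (a *: x) = a *: (z ** x).
Proof. by rewrite pmulC pmulZl pmulC. Qed.

Lemma pmulDr x y z : z ** (x + y) = z ** x + z ** y.
Proof. by rewrite pmulC pmulDl ![_ ** z]pmulC. Qed.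

Lemma pmulBr x y z : z ** (x - y) = z ** x - z ** y.
Proof. by rewrite -scaleN1r pmulDr pmulZr scaleN1r. Qed.

Lemma pmulAC x y z : x ** y ** z = x ** z ** y.
Proof. by rewrite -!pmulA [y ** z]pmulC. Qed.

Lemma plieDZl a x y z : plie (a *: x + y) z = a *: plie x z + plie y z.
Proof. exact: (fst plie_bilinear). Qed.

Lemma plieDZr a x y z : plie z (a *: x + y) = a *: plie z x + plie z y.
Proof. exact: (snd plie_bilinear). Qed.

Lemma plie0l z : plie 0 z = 0.
Proof. by have := plieDZl (-1) 0 0 z; rewrite scaler0 addr0 scaleN1r addNr. Qed.

Lemma plieC x y : plie x y = - plie y x.
Proof.
have := pliexx (1 *: x + y); rewrite plieDZl !plieDZr !pliexx !scale1r.
by rewrite add0r addr0 => /eqP; rewrite addr_eq0 => /eqP.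
Qed.

(** * One-generated subalgebras are ideals *)

Definition assoc_subalgebra S :=
  subspace S /\ forall x y, S x -> S y -> S (x ** y).

(** An intersection of subalgebras rather than a set of polynomial values: as P
    has no unit, a polynomial in [{poly F}] cannot be evaluated at x, and
    membership in the intersection is its own induction principle. *)
Definition gen x : set P :=
  [set y | forall S, assoc_subalgebra S -> S x -> S y].

Lemma gen_mem x : gen x x.
Proof. by []. Qed.

Lemma gen_subalgebra x : assoc_subalgebra (gen x).
Proof.
split; first split.
- by move=> S [[]].
- move=> a y z gy gz S hS Sx; have [[_ h] _] := hS.
  by apply: h; [apply: gy | apply: gz].
- move=> y z gy gz S hS Sx; have [_ h] := hS.
  by apply: h; [apply: gy | apply: gz].
Qed.

(** A bracket is a derivation in its first argument, so its kernel there is a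
    subalgebra. *)
Lemma centralizer_subalgebra z : assoc_subalgebra [set y | plie y z = 0].
Proof.
split; first split => /=; first exact: plie0l.
- by move=> a x y hx hy; rewrite plieDZl hx hy scaler0 addr0.
- by move=> x y /= hx hy; rewrite plie_leibniz hx hy !pmul0r addr0.
Qed.

(** Both arguments are brought back to x by [centralizer_subalgebra], first
    directly and then through antisymmetry. *)
Lemma gen_commute x y z : gen x y -> gen x z -> plie y z = 0.
Proof.
move=> gy gz; apply: (gy _ (centralizer_subalgebra z)) => /=.
rewrite plieC; apply/eqP; rewrite oppr_eq0; apply/eqP.
by apply: (gz _ (centralizer_subalgebra x)); apply: pliexx.
Qed.

Lemma gen_poisson_subalgebra x : poisson_subalgebra (gen x).
Proof.
have [h1 h2] := gen_subalgebra x; split=> // y z gy gz.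
by rewrite (gen_commute gy gz); apply: subspace0 h1.
Qed.

Lemma gen_subset x y : gen x y -> gen y `<=` gen x.
Proof. by move=> gy z gz; apply: gz gy; apply: gen_subalgebra. Qed.

(** Elements of the subalgebra are the polynomials in x without constant term;
    this extracts the linear coefficient. *)
Lemma gen_decomp x y :
  gen x y -> exists a z, gen x z /\ y = a *: x + x ** z.
Proof.
have [hs hm] := gen_subalgebra x.
pose S := [set y | exists a z, gen x z /\ y = a *: x + x ** z].
have SG w : S w -> gen x w.
  move=> [a [z [gz ->]]]; apply: (subspaceD hs); last exact: hm.
  exact: (subspaceZ _ hs).
move=> gy; apply: (gy S); last first.
  by exists 1, 0; rewrite pmul0r addr0 scale1r; split=> //; apply: subspace0 hs.
split; first split.
- by exists 0, 0; rewrite pmul0r scale0r addr0; split=> //; apply: subspace0 hs.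
- move=> a _ _ [b [z [gz ->]]] [c [t [gt ->]]].
  exists (a * b + c), (a *: z + t); split; first by apply: hs.2.
  by rewrite pmulDr pmulZr scalerDr scalerDl scalerA addrACA.
- move=> _ w [a [z [gz ->]]] /SG gw; exists 0, (a *: w + z ** w); split.
    by apply: hs.2 => //; apply: hm.
  by rewrite scale0r add0r pmulDl pmulZl pmulDr pmulZr pmulA.
Qed.

Lemma idempotent_line_subalgebra e :
  idempotent_elt e -> assoc_subalgebra [set a *: e | a in [set: F]].
Proof.
move=> he; split; first exact: subspace_line.
move=> _ _ [a _ <-] [b _ <-]; exists (a * b) => //.
by rewrite pmulZl pmulZr he scalerA.
Qed.

Lemma annihilator_subspace e : subspace [set x | e ** x = 0].
Proof.
split=> /= [|a x y hx hy]; first exact: pmul0r.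
by rewrite pmulDr pmulZr hx hy scaler0 addr0.
Qed.

Lemma prod_span_subset S I N :
  subspace I -> (forall x y, S x -> N y -> I (x ** y)) ->
  prod_span S N `<=` I.
Proof.
move=> hI h; apply: lspan_subset_subspace => // _ [x Sx [y Ny <-]].
exact: h.
Qed.

Hypothesis hP : dedekind P.

(** The only consequence of the Dedekind condition on which the rest relies. *)
Lemma gen_absorb x y z : gen x z -> gen x (y ** z).
Proof. by case: (hP (gen_poisson_subalgebra x)) => _ h _ /h. Qed.

(** * Idempotents *)

(** Put x^3 = a x^2 + x^2 w in <x^2>.  If a <> 0, this can be solved for
    x^2 = x^2 u; if a = 0, then w itself is divisible by x^2, and
    x^3 = x^2 w = x^3 u for some u. *)
Lemma cube_local_unit x : exists2 u, gen x u & x ** x ** x ** u = x ** x ** x.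
Proof.
have [hs hm] := gen_subalgebra x.
have gxx : gen x (x ** x) by apply: hm.
have [a [w [gw e3]]] := gen_decomp (gen_absorb x (@gen_mem (x ** x))).
move: e3; rewrite pmulA => e3.
have [a0|a0] := eqVneq a 0.
  have [b [t [gt ew]]] := gen_decomp gw.
  exists (b *: x + x ** t).
    apply: hs.2 => //; apply: hm => //; exact: (gen_subset gxx).
  rewrite [in RHS]e3 a0 scale0r add0r ew !pmulDr !pmulZr !pmulA.
  by congr (_ + _).
exists (a^-1 *: (x - w)).
  apply: (subspaceZ _ hs); apply: (subspaceB hs) => //.
  exact: (gen_subset gxx).
have {}e3 : x ** x ** (a^-1 *: (x - w)) = x ** x.
  by rewrite pmulZr pmulBr e3 addrK scalerA mulVf // scale1r.
by rewrite [LHS]pmulAC e3.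
Qed.

(** The idempotent is u^3 for u a local unit of x^3: as u is divisible by x,
    u^3 is divisible by x^3 and so is itself fixed by u. *)
Lemma idempotent_absorbing_cube x :
  exists g, [/\ gen x g, idempotent_elt g & x ** x ** x ** g = x ** x ** x].
Proof.
have [hs hm] := gen_subalgebra x.
have [u gu eu] := cube_local_unit x.
pose K := [set y | y ** u = y].
have KM y z : K y -> K (y ** z) by rewrite /K /= pmulAC => ->.
have KD a y z : K y -> K z -> K (a *: y + z).
  by rewrite /K /= => hy hz; rewrite pmulDZl hy hz.
have [a [w [gw u_def]]] := gen_decomp gu.
have Ku y : K (y ** x) -> K (y ** u).
  move=> Ky; rewrite u_def pmulDr pmulZr pmulA; apply: KD => //; exact: KM.
have Kg : K (u ** u ** u).
  apply: (Ku); rewrite (pmulAC u u x); apply: (Ku).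
  by rewrite -pmulA pmulC; apply: (Ku).
exists (u ** u ** u); split; first by do 2!apply: (hm) => //.
  by rewrite /idempotent_elt !pmulA !Kg.
by rewrite !pmulA !eu.
Qed.

Lemma idempotent_mul_line e y :
  idempotent_elt e -> exists a, y ** e = a *: e.
Proof.
move=> he.
have [a _ <-] : [set a *: e | a in [set: F]] (y ** e).
  apply: (gen_absorb y (@gen_mem e) (idempotent_line_subalgebra he)).
  by exists 1; rewrite ?scale1r.
by exists a.
Qed.

Lemma idempotent_unique e f :
  e <> 0 -> idempotent_elt e -> f <> 0 -> idempotent_elt f -> e = f.
Proof.
move=> /eqP e0 he /eqP f0 hf.
have [a fe] := idempotent_mul_line f he.
have [b ef] := idempotent_mul_line e hf.
have [a0|a0] := eqVneq a 0.
  (* Orthogonal case: e = c (e + f) gives 0 = c f after multiplying by f. *)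
  move: fe ef; rewrite a0 scale0r => fe; rewrite pmulC fe => _.
  have hef : idempotent_elt (e + f).
    by rewrite /idempotent_elt pmulDl !pmulDr he hf fe pmulC fe addr0 add0r.
  have [c] := idempotent_mul_line e hef.
  rewrite pmulDr he pmulC fe addr0 => ec.
  have := congr1 (pmul f) ec.
  rewrite pmulZr pmulDr fe hf add0r => /esym/eqP.
  rewrite scaler_eq0 (negPf f0) orbF => /eqP c0.
  by move: e0; rewrite ec c0 scale0r eqxx.
have b0 : b != 0.
  apply: contraNneq a0 => b0; have /eqP := fe.
  by rewrite pmulC ef b0 scale0r eq_sym scaler_eq0 (negPf e0) orbF.
have fix_eigen (g h : P) c :
  idempotent_elt g -> g ** h = c *: h -> c != 0 -> g ** h = h.
  move=> hg gh c0; rewrite gh; apply: (scalerI c0).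
  by rewrite -gh -pmulZr -gh pmulA hg.
by rewrite -(fix_eigen _ _ _ hf fe a0) pmulC (fix_eigen _ _ _ he ef b0).
Qed.

Lemma maximal_idempotent :
  exists2 e : P, idempotent_elt e &
    forall g : P, idempotent_elt g -> g = 0 \/ g = e.
Proof.
have [[e [e0 he]]|no] := EM (exists e : P, e <> 0 /\ idempotent_elt e).
  exists e => // g hg; have [->|/eqP g0] := eqVneq g 0; first by left.
  by right; apply: idempotent_unique.
exists 0; first exact: pmul0l.
move=> g hg; left; have [//|/eqP g0] := eqVneq g 0.
by case: no; exists g.
Qed.

Lemma peirce_direct_sum e : idempotent_elt e ->
  assoc_direct_sum [set a *: e | a in [set: F]] [set x | e ** x = 0].
Proof.
move=> he; split.
- split; first exact: subspace_line.
  move=> x _ [b _ <-]; have [a xe] := idempotent_mul_line x he.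
  by exists (b * a); rewrite // pmulZr xe scalerA.
- split; first exact: annihilator_subspace.
  by move=> x y /= ey; rewrite pmulC -pmulA [y ** e]pmulC ey pmul0r.
- move=> x; have [a xe] := idempotent_mul_line x he.
  exists (a *: e), (x - a *: e); split.
  + by exists a.
  + by rewrite /= pmulBr pmulC xe pmulZr he subrr.
  + by rewrite addrC subrK.
- apply/seteqP; split=> [_ [[a _ <-]] /=|_ ->].
    by rewrite pmulZr he.
  by split; [exists 0; rewrite ?scale0r | apply: pmul0r].
Qed.

(** The idempotent of <x> that fixes x^3 is 0 or e, and both kill x. *)
Lemma peirce_cube0 e :
  (forall g : P, idempotent_elt g -> g = 0 \/ g = e) ->
  forall x, e ** x = 0 -> x ** x ** x = 0.
Proof.
move=> emax x ex; have [g [gg hg gx]] := idempotent_absorbing_cube x.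
rewrite -gx; case: (emax g hg) => [->|->]; first exact: pmul0r.
by rewrite pmulC pmulA pmulA ex !pmul0l.
Qed.

(** * The nil part *)

Section NilPart.
Variable N : set P.
Hypothesis N_ideal : assoc_ideal N.
Hypothesis N_cube0 : forall x, N x -> x ** x ** x = 0.

(** In <x> = Fx + Fx^2, an equation xy = a x + b x^2 reads x(y - b x) = a x; the
    nilpotency of y - b x forces x = 0 as soon as a <> 0. *)
Lemma mul_sub_sq x y : N x -> N y -> exists b, x ** y = b *: (x ** x).
Proof.
move=> Nx Ny; have x3 := N_cube0 Nx.
have [a [w [gw]]] := gen_decomp (gen_absorb y (@gen_mem x)).
have [b [t [gt ->]]] := gen_decomp gw.
have [c [s [_ ->]]] := gen_decomp gt.
rewrite !pmulDr !pmulZr !pmulA x3 pmul0l scaler0 !addr0 [y ** x]pmulC => xy.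
have [a0|a0] := eqVneq a 0; first by exists b; rewrite xy a0 scale0r add0r.
set z := y - b *: x.
have Nz : N z.
  by apply: (subspaceB N_ideal.1) => //; apply: (subspaceZ _ N_ideal.1).
have xz : x ** z = a *: x by rewrite pmulBr pmulZr xy addrK.
exists 0; rewrite scale0r; suff -> : x = 0 by rewrite pmul0l.
have /eqP : x ** (z ** z ** z) = 0 by rewrite (N_cube0 Nz) pmul0r.
rewrite !pmulA xz !(pmulZl, xz) !scaler_eq0 (negPf a0) /=.
by move/eqP.
Qed.

Lemma nil_Ann : Ann N = [set x | N x /\ x ** x = 0].
Proof.
apply/seteqP; split=> x [Nx h]; split=> //; first exact: h.
move=> y Ny; have [b ->] := mul_sub_sq Nx Ny.
by rewrite h scaler0.
Qed.

(** xyz is a multiple of x^2 z, hence of (x^2)^2 by [mul_sub_sq] at x^2. *)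
Lemma nil_mul3 x y z : N x -> N y -> N z -> x ** y ** z = 0.
Proof.
move=> Nx Ny Nz; have [b ->] := mul_sub_sq Nx Ny.
have Nxx : N (x ** x) by apply: N_ideal.2.
have [c xz] := mul_sub_sq Nxx Nz.
by rewrite pmulZl xz pmulA (N_cube0 Nx) pmul0l !scaler0.
Qed.

Lemma nil_prod3 : prod_span (prod_span N N) N = [set 0].
Proof.
apply/seteqP; split; last by move=> _ ->; apply: lspan0.
apply: prod_span_subset; first exact: subspace_set0.
move=> p z Np Nz /=; rewrite pmulC.
have sub : prod_span N N `<=` [set q | z ** q = 0].
  apply: prod_span_subset; first exact: annihilator_subspace.
  by move=> x y Nx Ny /=; rewrite pmulC; apply: nil_mul3.
exact: sub.
Qed.

(** If xy is nonzero, it is a multiple of both x^2 and y^2.  If xy = 0, then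
    x^2 = (x + y)x is a multiple d (x + y)^2 = d (x^2 + y^2), which is solved
    for y^2. *)
Lemma squares_collinear x y :
  N x -> N y -> x ** x != 0 -> exists c, y ** y = c *: (x ** x).
Proof.
move=> Nx Ny x0.
have [b yx] := mul_sub_sq Ny Nx; have [c xy] := mul_sub_sq Nx Ny.
have [b0|b0] := eqVneq b 0; last first.
  by exists (b^-1 * c); rewrite -scalerA -xy pmulC yx scalerA mulVf // scale1r.
move: yx; rewrite b0 scale0r => yx {c xy b b0}.
have Nxy : N (x + y) by apply: (subspaceD N_ideal.1).
have [d] := mul_sub_sq Nxy Nx.
rewrite pmulDl yx !pmulDr !pmulDl yx pmulC yx addr0 add0r => xx.
have d0 : d != 0 by apply: contraNneq x0 => d0; rewrite xx d0 scale0r.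
exists (d^-1 - 1); rewrite scalerBl scale1r [in d^-1 *: _]xx scalerA mulVf //.
by rewrite scale1r [x ** x + _]addrC addrK.
Qed.

Lemma nil_dim_square : dim_le (prod_span N N) 1.
Proof.
have [[x [Nx /eqP x0]]|no] := EM (exists x : P, N x /\ x ** x <> 0).
  exists 1%N, (fun=> x ** x); split=> //; split.
    move=> c; rewrite big_ord1 => /eqP; rewrite scaler_eq0 (negPf x0) orbF.
    by move=> /eqP c0 i; rewrite ord1.
  rewrite lspan_line; apply/seteqP; split.
    move=> _ [a _ <-]; exists 1%N, (fun=> a), (fun=> x ** x); split.
      by move=> _; exists x => //; exists x.
    by rewrite big_ord1.
  apply: prod_span_subset; first exact: subspace_line.
  move=> y z Ny Nz; have [b ->] := mul_sub_sq Ny Nz.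
  have [c ->] := squares_collinear Nx Ny x0.
  by exists (b * c); rewrite ?scalerA.
exists 0%N, (fun=> 0 : P); split=> //; split; first by move=> c _ [].
apply/seteqP; split.
  apply: (@subset_trans _ [set (0 : P)]); last by move=> _ ->; apply: lspan0.
  apply: lspan_subset_subspace; first exact: subspace_set0.
  by move=> ? [[]].
apply: (@subset_trans _ [set (0 : P)]); last by move=> _ ->; apply: lspan0.
apply: prod_span_subset; first exact: subspace_set0.
move=> y z Ny Nz /=; have [b ->] := mul_sub_sq Ny Nz.
have [->|/eqP y0] := eqVneq (y ** y) 0; first exact: scaler0.
by case: no; exists y.
Qed.

End NilPart.
End PoissonTheory.

Unset Implicit Arguments.

Theorem theorem4p5 (F : fieldType) (P : poissonAlgType F) (hP : dedekind P) :
  (exists E N : set P,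
     [/\ assoc_direct_sum E N,
         E = [set 0] \/
         (exists e : P, [/\ e <> 0, idempotent_elt e,
            E = [set a *: e | a in [set: F]] &
            forall x, N x -> pmul e x = 0]),
         prod_span (prod_span N N) N = [set 0],
         dim_le (prod_span N N) 1 &
         Ann N = [set x | N x /\ pmul x x = 0]])
  /\ (forall e f : P, e <> 0 -> idempotent_elt e ->
        f <> 0 -> idempotent_elt f -> e = f).
Proof.
split; last exact: idempotent_unique.
have [e he emax] := maximal_idempotent hP.
have sum := peirce_direct_sum hP he.
have N_ideal : assoc_ideal [set x | pmul e x = 0] by case: sum.
have N_cube0 := peirce_cube0 hP emax.
exists [set a *: e | a in [set: F]], [set x | pmul e x = 0]; split=> //.
- have [e0|/eqP e0] := eqVneq e 0; [left|by right; exists e].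
  apply/seteqP; split=> [_ [a _ <-] | _ ->]; first by rewrite /= e0 scaler0.
  by exists 0; rewrite ?scale0r.
- exact: nil_prod3.
- exact: nil_dim_square.
- exact: nil_Ann.
Qed.
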